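(* Let $d\ge 2$ be an integer and let $$\sigma_d=\frac{2}{\pi}\int_0^\infty\left(\frac{\sin t}{t}\right)^d\,dt.$$ For any unit vector $\mathbf s=(s_1,\ldots,s_d)\in\mathbb S^{d-1}$, $$\frac{2\|\mathbf s\|_1}{\pi d}\int_0^\infty\prod_{i=1}^d\frac{\sin (s_i t)}{s_i t}\,dt\le \sigma_d .$$
   Context: $\mathbb S^{d-1}=\{\mathbf s\in\mathbb R^d:\|\mathbf s\|_2=1\}$ is the Euclidean unit sphere, and $\|\mathbf s\|_1=\sum_{i=1}^d|s_i|$. The factor $\frac{\sin(s_i t)}{s_i t}$ is understood to equal $1$ when $s_i t=0$. Integrals over $(0,\infty)$ are improper Riemann integrals $\lim_{T\to\infty}\int_0^T$. *)

(* Defs.v *)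
From Stdlib Require Import Reals.
From Coquelicot Require Import Coquelicot.
From mathcomp Require Import all_boot all_order all_algebra.
From mathcomp Require Import Rstruct.

Set Implicit Arguments.
Unset Strict Implicit.
Unset Printing Implicit Defensive.

Import Order.TTheory GRing.Theory Num.Theory.
Local Open Scope ring_scope.

Definition l1norm (d : nat) (s : 'rV[R]_d) : R := \sum_(i < d) `|s ord0 i|.

Definition l2norm (d : nat) (s : 'rV[R]_d) : R :=
  Num.sqrt (\sum_(i < d) s ord0 i ^+ 2).

Definition sinc (x : R) : R := if x == 0 then 1 else sin x / x.

(* [at_point 0] pins the lower endpoint at 0, so these are statements about    *)
(* the Riemann integral of f over [0, T] as T tends to +oo.                    *)
Definition ex_improper (f : R -> R) : Prop :=
  ex_RInt_gen f (at_point (0 : R)) (Rbar_locally p_infty).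

(* Meaningful only under [ex_improper f]; unspecified otherwise.               *)
Definition improper (f : R -> R) : R :=
  RInt_gen f (at_point (0 : R)) (Rbar_locally p_infty).

Definition sinc_pow (d : nat) (t : R) : R := sinc t ^+ d.

Definition sinc_prod (d : nat) (s : 'rV[R]_d) (t : R) : R :=
  \prod_(i < d) sinc (s ord0 i * t)%R.

Definition sigma_d (d : nat) : R := (2 / PI * improper (sinc_pow d))%R.

(* Main.v *)
Require Import Defs.
From Stdlib Require Import Reals Lra.
From Coquelicot Require Import Coquelicot.
From mathcomp Require Import all_boot all_order all_algebra.
From mathcomp Require Import Rstruct.

Import Order.TTheory GRing.Theory Num.Theory.
Local Open Scope ring_scope.

Local Open Scope R_scope.

(** Up to a constant factor, the integral of prod_i sinc (s_i t) over the half
line is the density at 0 of the sum of the s_i U_i, where the U_i are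
independent and uniform on [-1, 1]. Signs do not matter, since sinc is even.
Scaling turns the claim into the assertion that, among nonnegative vectors with
a given coordinate sum d mu, this density is largest at (mu, ..., mu). The
reason is a transfer principle: moving two coordinates a >= b towards each
other at a fixed sum c makes the law of a U_1 + b U_2 (a trapezoid on [-c, c])
more concentrated around 0, and adding further symmetric uniform variables
preserves this order. Finitely many transfers, each of which sets one
coordinate equal to mu, lead to the constant vector.

Everything is carried out on the truncated integrals over [0, T], with errors
O(1/T), so that neither Fourier inversion nor Fubini enters. The kernel
phi x t = sin (x t) / t plays the role of the indicator of [-x, x]: up to a
factor, the integral of g * phi x is the mass that the law with characteristic
function g gives to [-x, x]. Four facts carry the argument.

- [smoothing]: if the integral of G * phi x is at least -e for every x >= 0, so
  is that of G * sinc (a .) * phi x. This is the stability of the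
  concentration order under the addition of a uniform variable. As a function
  of the parameter u, the integral of G * phi x * phi u has derivative
  half the sum of the values at x + u and x - u, and it is symmetric in (x, u).

- [RInt_phi_phi]: the integral of phi x * phi u is kappa min(x, u) + O(1/T),
  from the scaling behaviour of the integral of (1 - cos (y t)) / t^2. The
  constant kappa (that is, pi / 2) enters as a supremum.

- [trap_antitone]: the trapezoids are ordered. The trapezoid with flat part
  [-u, u] is a mixture of uniform laws on [-y, y], u <= y <= c, and lowering u
  adds more concentrated components.

- [dominated_mean]: the sequence of transfers.

A further coordinate x > 0 lets phi x = x sinc (x .) itself serve as the test
kernel that turns the comparison of masses into the comparison of the integrals.
When all coordinates other than the two that are moved vanish, the integral is
kappa / max(a, b) and is compared directly; for b = 0 this is the Dirichlet
integral ([pair_limit]). *)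

(** * The function sinc and calculus of continuous functions *)

Lemma sinc0 : sinc 0 = 1.
Proof. by rewrite /sinc eqxx. Qed.

Lemma sincE x : x <> 0 -> sinc x = sin x / x.
Proof. by move=> x0; rewrite /sinc; case: eqP => // _; rewrite -RdivE //. Qed.

Lemma mul_sinc x : x * sinc x = sin x.
Proof.
have [->|x0] := Req_dec x 0; first by rewrite sin_0; lra.
by rewrite sincE //; field.
Qed.

Lemma sincN x : sinc (- x) = sinc x.
Proof.
have [->|x0] := Req_dec x 0; first by rewrite Ropp_0.
by rewrite !sincE ?sin_neg; [field|lra|lra].
Qed.

Lemma continuous_sinc x : continuous sinc x.
Proof.
have [->|x0] := Req_dec x 0.
  apply/continuity_pt_filterlim/continuity_pt_filterlim'; rewrite sinc0.
  apply: (filterlim_ext_loc (fun x => sin x / x)); last exact: is_lim_sinc_0.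
  by exists (mkposreal 1 Rlt_0_1) => y _ y0; rewrite sincE.
apply: (continuous_ext_loc _ (fun x => sin x / x)).
  have px : 0 < Rabs x by exact: Rabs_pos_lt.
  exists (mkposreal _ px) => y /= xy.
  rewrite sincE // => y0; move: xy; rewrite y0 /ball /= /AbsRing_ball /abs /minus /plus /opp /= .
  by rewrite Rplus_0_l Rabs_Ropp; lra.
apply: (@ex_derive_continuous R_AbsRing R_NormedModule).
by auto_derive.
Qed.

Lemma Rabs_sinc_le1 x : Rabs (sinc x) <= 1.
Proof.
have [->|x0] := Req_dec x 0; first by rewrite sinc0 Rabs_R1; lra.
have px : 0 < Rabs x by exact: Rabs_pos_lt.
apply: (Rmult_le_reg_l (Rabs x)) => //.
rewrite -Rabs_mult mul_sinc Rmult_1_r.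
have key y : 0 < y -> Rabs (sin y) <= y.
  move=> y0; have := sin_lt_x y y0; have := SIN_bound y => sb slt.
  case: (Rle_dec y 1) => y1; last by apply: Rabs_le; lra.
  have s0 : 0 <= sin y by apply: sin_ge_0; have := PI2_1; lra.
  by rewrite Rabs_pos_eq; lra.
case: (Rle_dec 0 x) => xs; first by rewrite (Rabs_pos_eq x) //; apply: key; lra.
rewrite (Rabs_left x); last lra.
by rewrite -Rabs_Ropp -sin_neg; apply: key; lra.
Qed.

(** Integrability is only ever needed for continuous integrands, for which it
is automatic on every interval. *)
Definition cts (f : R -> R) := forall x, continuous f x.

Lemma cts_ext f g : (forall t, f t = g t) -> cts f -> cts g.
Proof. by move=> fg cf x; apply: (continuous_ext f). Qed.

Lemma cts_mul f g : cts f -> cts g -> cts (fun t => f t * g t).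
Proof. by move=> cf cg x; apply: (@continuous_mult R_UniformSpace R_AbsRing). Qed.

Lemma cts_sub f g : cts f -> cts g -> cts (fun t => f t - g t).
Proof. by move=> cf cg x; apply: (@continuous_minus R_UniformSpace R_AbsRing R_NormedModule). Qed.

Lemma cts_const c : cts (fun _ => c).
Proof. by move=> x; apply: continuous_const. Qed.

Lemma cts_sinc a : cts (fun t => sinc (a * t)).
Proof.
move=> x; apply: (continuous_comp (fun t => a * t) sinc); last exact: continuous_sinc.
apply: (@continuous_mult R_UniformSpace R_AbsRing); first exact: continuous_const.
exact: continuous_id.
Qed.

Lemma ex_RInt_cts f a b : cts f -> ex_RInt f a b.
Proof. by move=> cf; apply: (@ex_RInt_continuous R_CompleteNormedModule) => x _; apply: cf. Qed.

Lemma RInt_subf f g a b : cts f -> cts g ->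
  RInt (fun t => f t - g t) a b = RInt f a b - RInt g a b.
Proof. by move=> cf cg; apply: (@RInt_minus R_CompleteNormedModule); apply: ex_RInt_cts. Qed.

Lemma RInt_mull c f a b : cts f -> RInt (fun t => c * f t) a b = c * RInt f a b.
Proof. by move=> cf; apply: (@RInt_scal R_CompleteNormedModule); apply: ex_RInt_cts. Qed.

Lemma RInt_addf f g a b : cts f -> cts g ->
  RInt (fun t => f t + g t) a b = RInt f a b + RInt g a b.
Proof. by move=> cf cg; apply: (@RInt_plus R_CompleteNormedModule); apply: ex_RInt_cts. Qed.

Lemma RInt_eqf (f g : R -> R) a b : (forall t, f t = g t) -> RInt f a b = RInt g a b.
Proof. by move=> fg; apply: RInt_ext => t _. Qed.

(** * Differentiation in the parameter of a kernel *)

Lemma is_derive_RInt_kernel (k k' : R -> R -> R) (h : R -> R) T u :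
  cts h -> (forall z t, is_derive (fun y => k y t) z (k' z t)) ->
  (forall z t, continuity_2d_pt k' z t) -> (forall z, cts (k z)) ->
  is_derive (fun z => RInt (fun t => h t * k z t) 0 T) u
            (RInt (fun t => h t * k' u t) 0 T).
Proof.
move=> ch dk ck' ck.
have D z t : is_derive (fun y => h t * k y t) z (h t * k' z t).
  by apply: (is_derive_scal (fun y => k y t)).
have E z t : Derive (fun y => h t * k y t) z = h t * k' z t by apply: is_derive_unique.
rewrite -(RInt_eqf (fun t => Derive (fun y => h t * k y t) u)) //.
apply: is_derive_RInt_param.
- by apply: filter_forall => z t _; eexists; apply: D.
- move=> t _; apply: (continuity_2d_pt_ext (fun u v => h v * k' u v)); first by move=> x y; rewrite E.
  apply: continuity_2d_pt_mult => //.
  apply: (continuity_1d_2d_pt_comp h (fun _ v => v)); last exact: continuity_2d_pt_id2.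
  by apply/continuity_pt_filterlim; apply: ch.
- by apply: filter_forall => z; apply: ex_RInt_cts; apply: cts_mul.
Qed.

(** These are sin (x t) / t and (1 - cos (y t)) / t^2, written through sinc so
that they are smooth across t = 0. *)
Definition phi (x t : R) : R := x * sinc (x * t).
Definition psi (y t : R) : R := 2 * (phi (y / 2) t * phi (y / 2) t).

Lemma phi0 x : phi x 0 = x.
Proof. by rewrite /phi Rmult_0_r sinc0; lra. Qed.

Lemma phiE x t : t <> 0 -> phi x t = sin (x * t) / t.
Proof. by move=> t0; rewrite -mul_sinc /phi; field. Qed.

Lemma cts_phi x : cts (phi x).
Proof. by apply: cts_mul; [exact: cts_const | exact: cts_sinc]. Qed.

Lemma psiE y t : t <> 0 -> psi y t = (1 - cos (y * t)) / (t * t).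
Proof.
move=> t0; rewrite /psi !phiE //.
have -> : y * t = 2 * (y / 2 * t) by lra.
by rewrite cos_2a_sin; field.
Qed.

Lemma psi_ge0 y t : 0 <= psi y t.
Proof. by rewrite /psi; have := Rle_0_sqr (phi (y / 2) t); rewrite /Rsqr; lra. Qed.

Lemma cts_psi y : cts (psi y).
Proof. by apply: cts_mul; [exact: cts_const|apply: cts_mul; exact: cts_phi]. Qed.

Lemma is_derive_phi u t : is_derive (fun z => phi z t) u (cos (u * t)).
Proof.
have [->|t0] := Req_dec t 0.
  apply: (is_derive_ext id) => [z|]; first by rewrite phi0.
  by rewrite Rmult_0_r cos_0; apply: is_derive_id.
apply: (is_derive_ext (fun z => sin (z * t) / t)) => [z|]; first by rewrite phiE.
by auto_derive => //; field.
Qed.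

(** The product formula for two sines. *)
Lemma psi_diff x u t : psi (x + u) t - psi (x - u) t = 2 * (phi u t * phi x t).
Proof.
have [->|t0] := Req_dec t 0; first by rewrite /psi !phi0; field.
rewrite !psiE // !phiE // !Rmult_minus_distr_r !Rmult_plus_distr_r cos_plus cos_minus.
by field.
Qed.

(** Also a product formula; it expresses the derivative of phi u * phi x in u
by the kernel phi itself, at shifted parameters. *)
Lemma two_cos_phi x u t :
  2 * (cos (u * t) * phi x t) = phi (x + u) t + phi (x - u) t.
Proof.
have [->|t0] := Req_dec t 0; first by rewrite !phi0 Rmult_0_r cos_0; lra.
rewrite !phiE // !Rmult_minus_distr_r !Rmult_plus_distr_r sin_plus sin_minus.
by field.
Qed.

Lemma is_derive_psi u t : is_derive (fun z => psi z t) u (phi u t).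
Proof.
have d : is_derive (fun z => phi (z / 2) t) u (1 / 2 * cos (u / 2 * t)).
  apply: (is_derive_comp (fun z => phi z t) (fun z => z / 2)); first exact: is_derive_phi.
  by auto_derive => //; lra.
have -> : phi u t = 2 * (1 / 2 * cos (u / 2 * t) * phi (u / 2) t
                     + phi (u / 2) t * (1 / 2 * cos (u / 2 * t))).
  have := two_cos_phi (u / 2) (u / 2) t.
  have -> : u / 2 + u / 2 = u by lra.
  have -> : u / 2 - u / 2 = 0 by lra.
  have -> : phi 0 t = 0 by rewrite /phi; lra.
  lra.
apply: is_derive_scal; apply: (is_derive_mult (K := R_AbsRing)) => //.
by move=> n m; apply: Rmult_comm.
Qed.

Lemma continuity_2d_phi u t : continuity_2d_pt phi u t.
Proof.
apply: continuity_2d_pt_mult; first exact: continuity_2d_pt_id1.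
apply: (continuity_1d_2d_pt_comp sinc (fun u v => u * v)).
  by apply/continuity_pt_filterlim; apply: continuous_sinc.
by apply: continuity_2d_pt_mult; [exact: continuity_2d_pt_id1|exact: continuity_2d_pt_id2].
Qed.

Lemma continuity_2d_cos u t : continuity_2d_pt (fun u t => cos (u * t)) u t.
Proof.
apply: (continuity_1d_2d_pt_comp cos (fun u v => u * v)); first exact: continuity_cos.
by apply: continuity_2d_pt_mult; [exact: continuity_2d_pt_id1|exact: continuity_2d_pt_id2].
Qed.

Lemma is_derive_RInt_phi h T u : cts h ->
  is_derive (fun z => RInt (fun t => h t * phi z t) 0 T) u
            (RInt (fun t => h t * cos (u * t)) 0 T).
Proof.
move=> ch; apply: (is_derive_RInt_kernel phi (fun u t => cos (u * t))) => //.
- exact: is_derive_phi.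
- exact: continuity_2d_cos.
- exact: cts_phi.
Qed.

Lemma is_derive_RInt_psi h T u : cts h ->
  is_derive (fun z => RInt (fun t => h t * psi z t) 0 T) u
            (RInt (fun t => h t * phi u t) 0 T).
Proof.
move=> ch; apply: (is_derive_RInt_kernel psi phi) => //.
- exact: is_derive_psi.
- exact: continuity_2d_phi.
- exact: cts_psi.
Qed.

(** Comparing increments through derivatives replaces here all integrations in
a parameter, hence also every exchange of two integrals. *)
Lemma increment_le (f g f' g' : R -> R) a b : a <= b ->
  (forall u, a <= u <= b -> is_derive f u (f' u)) ->
  (forall u, a <= u <= b -> is_derive g u (g' u)) ->
  (forall u, a <= u <= b -> g' u <= f' u) -> g b - g a <= f b - f a.
Proof.
move=> ab df dg le.
have D u : a <= u <= b -> is_derive (fun z => f z - g z) u (f' u - g' u).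
  by move=> uab; apply: (@is_derive_minus R_AbsRing R_NormedModule); [apply: df|apply: dg].
have [|x xab|v [vab]] := MVT_gen (fun z => f z - g z) a b (fun u => f' u - g' u);
  rewrite ?Rmin_left ?Rmax_right //.
- by move=> u uab; apply: D; lra.
- apply/continuity_pt_filterlim; apply: (ex_derive_continuous (fun z => f z - g z)).
  by eexists; apply: D; rewrite Rmin_left ?Rmax_right // in xab.
have vab' : a <= v <= b by rewrite Rmin_left ?Rmax_right // in vab.
have := le v vab'; move=> lev; nra.
Qed.

(** * Adding a uniform variable *)

(** For u in [0, a] with a <= x both parameters x + u and x - u are nonnegative,
so the derivative in u of the integral of G * phi x * phi u is at least - e. *)
Lemma smoothing_half (G : R -> R) T e a x : cts G ->
  (forall y, 0 <= y -> - e <= RInt (fun t => G t * phi y t) 0 T) ->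
  0 <= a <= x -> - e * a <= RInt (fun t => G t * phi x t * phi a t) 0 T.
Proof.
move=> cG He ax.
have cGx : cts (fun t => G t * phi x t) by apply: cts_mul => //; exact: cts_phi.
pose f z := RInt (fun t => G t * phi x t * phi z t) 0 T.
have f0 : f 0 = 0.
  rewrite /f (RInt_eqf _ (fun t => 0 * G t)); last by move=> t; rewrite /phi; lra.
  by rewrite RInt_mull //; lra.
have : - e * a - (- e * 0) <= f a - f 0; last by rewrite f0 /f; lra.
apply: (increment_le f (fun z => - e * z)
  (fun u => RInt (fun t => G t * phi x t * cos (u * t)) 0 T) (fun _ => - e)).
- lra.
- by move=> u _; apply: is_derive_RInt_phi.
- by move=> u _; auto_derive => //; lra.
move=> u ua /=.
have -> : RInt (fun t => G t * phi x t * cos (u * t)) 0 T =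
  / 2 * (RInt (fun t => G t * phi (x + u) t) 0 T + RInt (fun t => G t * phi (x - u) t) 0 T).
  have cg y : cts (fun t => G t * phi y t) by apply: cts_mul => //; exact: cts_phi.
  rewrite -RInt_addf // -RInt_mull; last first.
    move=> z; apply: (@continuous_plus R_UniformSpace R_AbsRing R_NormedModule); exact: cg.
  by apply: RInt_eqf => t; have := two_cos_phi x u t; nra.
have := He (x + u); have := He (x - u); lra.
Qed.

(** As a * sinc (a t) = phi a t, the product a times the integral is symmetric
in (a, x), and the case a > x reduces to the case a <= x. *)
Lemma smoothing (G : R -> R) T e a : cts G -> 0 <= e -> 0 <= a ->
  (forall x, 0 <= x -> - e <= RInt (fun t => G t * phi x t) 0 T) ->
  forall x, 0 <= x -> - e <= RInt (fun t => G t * sinc (a * t) * phi x t) 0 T.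
Proof.
move=> cG e0 a0 He x x0.
have [->|an0] := Req_dec a 0.
  rewrite (RInt_eqf _ (fun t => G t * phi x t)); first exact: He.
  by move=> t; rewrite Rmult_0_l sinc0; lra.
have cGs : cts (fun t => G t * sinc (a * t) * phi x t).
  by apply: cts_mul; [apply: cts_mul => //; exact: cts_sinc|exact: cts_phi].
apply: (Rmult_le_reg_l a); first lra.
rewrite -RInt_mull //.
case: (Rle_dec a x) => ax.
  rewrite (RInt_eqf _ (fun t => G t * phi x t * phi a t)); last by move=> t; rewrite /phi; ring.
  by have := smoothing_half G T e a x cG He; lra.
rewrite (RInt_eqf _ (fun t => G t * phi a t * phi x t)); last by move=> t; rewrite /phi; ring.
have xa : 0 <= x <= a by lra.
have := smoothing_half G T e x a cG He xa; nra.
Qed.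

(** * Asymptotics of the basic integrals *)

Definition Psi V := RInt (psi 1) 0 V.

(** Substitution of y t for t. *)
Lemma RInt_psi y T : 0 <= y -> RInt (psi y) 0 T = y * Psi (y * T).
Proof.
move=> y0; rewrite /Psi.
have := RInt_comp_lin (psi 1) y 0 0 T.
rewrite !Rplus_0_r Rmult_0_r => <-; last by apply: ex_RInt_cts; exact: cts_psi.
have c1 : cts (fun t => y * psi 1 (y * t + 0)).
  move=> t; apply: (@continuous_mult R_UniformSpace R_AbsRing); first exact: continuous_const.
  apply: (continuous_comp (fun t => y * t + 0) (psi 1)); last exact: cts_psi.
  apply: (@ex_derive_continuous R_AbsRing R_NormedModule); by auto_derive.
rewrite -RInt_mull //; apply: RInt_eqf => t.
rewrite /scal /= /mult /= Rplus_0_r /psi /phi.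
have -> : 1 / 2 * (y * t) = y / 2 * t by lra.
by field.
Qed.

Lemma is_derive_Psi V : is_derive Psi V (psi 1 V).
Proof.
apply: (is_derive_RInt (psi 1) Psi 0); last exact: cts_psi.
by apply: filter_forall => b; apply: RInt_correct; apply: ex_RInt_cts; exact: cts_psi.
Qed.

Lemma Psi0 : Psi 0 = 0.
Proof. by rewrite /Psi RInt_point. Qed.

Lemma Psi_mono V W : V <= W -> Psi V <= Psi W.
Proof.
move=> VW; suff : 0 - 0 <= Psi W - Psi V by lra.
apply: (increment_le Psi (fun _ => 0) (psi 1) (fun _ => 0)) => // u _.
- exact: is_derive_Psi.
- by apply: (@is_derive_const R_AbsRing R_NormedModule).
exact: psi_ge0.
Qed.

(** Since 1 - cos t <= 2, the integrand is at most 2 / t^2. *)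
Lemma Psi_tail V W : 0 < V -> V <= W -> Psi W - Psi V <= 2 / V.
Proof.
move=> V0 VW.
have : Psi W - Psi V <= - 2 / W - (- 2 / V).
  apply: (increment_le (fun z => - 2 / z) Psi (fun z => 2 / (z * z)) (psi 1)) => // u uVW.
  - by auto_derive; [lra|field; lra].
  - exact: is_derive_Psi.
  rewrite psiE; last lra.
  apply: Rmult_le_compat_r; last by have := COS_bound (1 * u); lra.
  by apply: Rlt_le; apply: Rinv_0_lt_compat; nra.
have : 0 < 2 / W by apply: Rdiv_lt_0_compat; lra.
rewrite /Rdiv; lra.
Qed.

(** The limit of Psi at infinity, which is its supremum as Psi is monotone. *)
Definition kappa : R := real (Lub_Rbar (fun y => exists V, y = Psi V)).

Lemma kappa_bounds V : 0 < V -> Psi V <= kappa <= Psi V + 2 / V.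
Proof.
rewrite /kappa => V0.
case: (Lub_Rbar_correct (fun y => exists V, y = Psi V)).
have ubd U : 0 < U -> is_ub_Rbar (fun y => exists V, y = Psi V) (Rbar.Finite (Psi U + 2 / U)).
  move=> U0 _ [W ->] /=; case: (Rle_dec U W) => UW; first by have := Psi_tail U W U0 UW; lra.
  have := Psi_mono W U; have : 0 < 2 / U by apply: Rdiv_lt_0_compat; lra.
  by lra.
case: (Lub_Rbar _) => [l||] ub /(_ _ (ubd V V0)) //= lb.
- by split => //; apply: (ub (Psi V)); exists V.
- by have := ub (Psi V) (ex_intro _ V erefl).
Qed.

Lemma kappa_ge0 : 0 <= kappa.
Proof. by have := kappa_bounds 1; have := Psi_mono 0 1; rewrite Psi0; lra. Qed.

Lemma RInt_psi_bounds y T : 0 < T ->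
  kappa * Rabs y - 2 / T <= RInt (psi y) 0 T <= kappa * Rabs y.
Proof.
move=> T0.
rewrite (RInt_eqf _ (psi (Rabs y))); last first.
  move=> t; case: (Rle_dec 0 y) => y0; first by rewrite Rabs_pos_eq.
  rewrite Rabs_left ?/psi ?/phi; last lra.
  have -> : - y / 2 * t = - (y / 2 * t) by lra.
  by rewrite sincN; field.
rewrite RInt_psi; last exact: Rabs_pos.
have T2 : 0 < 2 / T by apply: Rdiv_lt_0_compat; lra.
case: (Req_dec (Rabs y) 0) => [->|y0]; first lra.
have yp : 0 < Rabs y by have := Rabs_pos y; lra.
have := kappa_bounds (Rabs y * T) (Rmult_lt_0_compat _ _ yp T0).
have -> : 2 / (Rabs y * T) = 2 / T / Rabs y by field; lra.
set P := Psi _ => -[h1 h2].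
have : Rabs y * kappa <= Rabs y * (P + 2 / T / Rabs y) by apply: Rmult_le_compat_l; lra.
have -> : Rabs y * (P + 2 / T / Rabs y) = Rabs y * P + 2 / T by field; lra.
nra.
Qed.

(** By [psi_diff], and |x + u| - |x - u| = 2 min(x, u) for x, u >= 0. The error
bound is uniform in x and u, which the comparison of trapezoids requires. *)
Lemma RInt_phi_phi u x T : 0 <= u -> 0 <= x -> 0 < T ->
  kappa * Rmin x u - / T <= RInt (fun t => phi x t * phi u t) 0 T <= kappa * Rmin x u + / T.
Proof.
move=> u0 x0 T0.
have E : RInt (psi (x + u)) 0 T - RInt (psi (x - u)) 0 T =
         2 * RInt (fun t => phi x t * phi u t) 0 T.
  rewrite -RInt_subf; [|exact: cts_psi|exact: cts_psi].
  rewrite -RInt_mull; last by apply: cts_mul; exact: cts_phi.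
  by apply: RInt_eqf => t; rewrite psi_diff; lra.
have := RInt_psi_bounds (x + u) T T0; have := RInt_psi_bounds (x - u) T T0.
rewrite (Rabs_pos_eq (x + u)); last lra.
have -> : Rabs (x - u) = x + u - 2 * Rmin x u.
  by rewrite /Rmin /Rabs; case: Rle_dec; case: Rcase_abs; lra.
rewrite /Rdiv; lra.
Qed.

(** * The comparison of trapezoids *)

(** The characteristic function of the trapezoidal density with support [-c, c]
and flat part [-u, u]: the case a = (c + u) / 2, b = (c - u) / 2 of the sum
a U_1 + b U_2. *)
Definition trap c u t := sinc ((c + u) / 2 * t) * sinc ((c - u) / 2 * t).

Lemma cts_trap c u : cts (trap c u).
Proof. by apply: cts_mul; exact: cts_sinc. Qed.

Lemma trapE c u t : (c * c - u * u) * trap c u t = 2 * (psi c t - psi u t).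
Proof.
have := psi_diff ((c + u) / 2) ((c - u) / 2) t.
have -> : (c + u) / 2 + (c - u) / 2 = c by lra.
have -> : (c + u) / 2 - (c - u) / 2 = u by lra.
by move=> ->; rewrite /trap /phi; field.
Qed.

(** Together with [is_derive_RInt_psi] this presents the trapezoid as the mixture
over y in [u, c], with weight proportional to y, of uniform laws on [-y, y]. *)
Lemma trap_increment c u x T :
  (c * c - u * u) * RInt (fun t => trap c u t * phi x t) 0 T =
  2 * (RInt (fun t => phi x t * psi c t) 0 T - RInt (fun t => phi x t * psi u t) 0 T).
Proof.
have cp y : cts (fun t => phi x t * psi y t) by apply: cts_mul; [exact: cts_phi|exact: cts_psi].
rewrite -RInt_subf // -!RInt_mull.
- by apply: RInt_eqf => t; have := trapE c u t; nra.
- by apply: cts_sub.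
- by apply: cts_mul; [exact: cts_trap|exact: cts_phi].
Qed.

(** The uniform law on [-u, u] gives [-x, x] the mass min(x, u) / u, and this
decreases in u. *)
Lemma Rmin_div_antitone x u v : 0 <= x -> 0 <= u -> u <= v -> 0 < v ->
  u * (Rmin x v / v) <= Rmin x u.
Proof.
move=> x0 u0 uv v0.
apply: (Rmult_le_reg_r v) => //.
have -> : u * (Rmin x v / v) * v = u * Rmin x v by field; lra.
rewrite /Rmin; case: Rle_dec; case: Rle_dec; nra.
Qed.

(** Let k be the limiting value at the uniform law on [-v, v]. The components
with parameter in [v, c] contribute at most k each, so the trapezoid with flat
part [-v, v] has value at most k; passing to u adds components in [u, v], which
contribute at least k each. All errors are multiples of 1/T. *)
Lemma trap_antitone c u v x T : 0 < T -> 0 <= x -> 0 < c -> 0 <= u -> u <= v -> v <= c ->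
  - (4 / (c * T)) <= RInt (fun t => (trap c u t - trap c v t) * phi x t) 0 T.
Proof.
move=> T0 x0 c0 u0 uv vc.
have cc y : cts (fun t => trap c y t * phi x t) by apply: cts_mul; [exact: cts_trap|exact: cts_phi].
rewrite (RInt_eqf _ (fun t => trap c u t * phi x t - trap c v t * phi x t)); last by move=> t; ring.
rewrite RInt_subf //.
have TI : 0 < / T by exact: Rinv_0_lt_compat.
have e0 : 0 < 4 / (c * T) by apply: Rdiv_lt_0_compat; nra.
case: (Req_dec u v) => [->|neq]; first lra.
have v0 : 0 < v by lra.
pose k := kappa * (Rmin x v / v).
have k0 : 0 <= k.
  apply: Rmult_le_pos; first exact: kappa_ge0.
  by apply: Rdiv_le_0_compat => //; apply: Rmin_glb; lra.
pose P y := RInt (fun t => phi x t * psi y t) 0 T.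
pose P' y := RInt (fun t => phi x t * phi y t) 0 T.
have dP y : is_derive P y (P' y) by apply: is_derive_RInt_psi; exact: cts_phi.
(* q is the value that P would have if every component contributed exactly k;
   the sign s directs the error term. *)
pose q s y := k * (y * y) / 2 + s * (y / T).
have dq s y : is_derive (q s) y (k * y + s * / T).
  by rewrite /q; auto_derive => //; field; lra.
have kp := kappa_ge0.
have low : q (-1) v - q (-1) u <= P v - P u.
  apply: (increment_le P (q (-1)) P' (fun y => k * y + (-1) * / T)) => // y yuv.
  have [h _] := RInt_phi_phi y x T ltac:(lra) x0 T0.
  have := Rmin_div_antitone x y v x0 ltac:(lra) ltac:(lra) v0 => h2.
  rewrite /P'; apply: Rle_trans h; rewrite /k.
  have := Rmult_le_compat_l _ _ _ kp h2; lra.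
have up : P c - P v <= q 1 c - q 1 v.
  apply: (increment_le (q 1) P (fun y => k * y + 1 * / T) P') => // y yvc.
  have [_ h] := RInt_phi_phi y x T ltac:(lra) x0 T0.
  have y0 : 0 < y by lra.
  have := Rmin_div_antitone x v y x0 ltac:(lra) ltac:(lra) y0 => h2.
  rewrite /P'; apply: (Rle_trans _ _ _ h); rewrite /k.
  suff h3 : Rmin x y <= y * (Rmin x v / v) by have := Rmult_le_compat_l _ _ _ kp h3; lra.
  apply: (Rmult_le_reg_l (v / y)); first exact: Rdiv_lt_0_compat.
  have -> : v / y * Rmin x y = v * (Rmin x y / y) by field; lra.
  by have -> : v / y * (y * (Rmin x v / v)) = Rmin x v by field; lra.
have := trap_increment c u x T; have := trap_increment c v x T.
set Ju := RInt (fun t => trap c u t * phi x t) 0 T.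
set Jv := RInt (fun t => trap c v t * phi x t) 0 T.
rewrite -/(P c) -/(P u) -/(P v) => Ev Eu.
(* For v = c the trapezoid is the uniform law and the mixture is degenerate. *)
have Jvk : Jv <= k + 2 / (c * T).
  case: (Req_dec v c) => [vceq|vcneq].
    have E : c * Jv = RInt (fun t => phi x t * phi c t) 0 T.
      rewrite /Jv -RInt_mull //; apply: RInt_eqf => t; rewrite vceq /trap.
      have -> : (c + c) / 2 = c by lra.
      have -> : (c - c) / 2 * t = 0 by lra.
      by rewrite sinc0 /phi; ring.
    have [_ h] := RInt_phi_phi c x T (Rlt_le _ _ c0) x0 T0.
    apply: (Rmult_le_reg_l c) => //; rewrite E.
    apply: (Rle_trans _ _ _ h); rewrite /k vceq.
    have -> : c * (kappa * (Rmin x c / c) + 2 / (c * T)) = kappa * Rmin x c + 2 * / T by field; lra.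
    lra.
  have h : (c * c - v * v) * Jv <= k * (c * c - v * v) + 2 * (c - v) / T.
    rewrite Ev; move: up; rewrite /q; lra.
  apply: (Rmult_le_reg_l ((c - v) * (c + v))); first nra.
  apply: (Rle_trans _ ((c * c - v * v) * Jv)); first by right; ring.
  apply: (Rle_trans _ _ _ h).
  have -> : (c - v) * (c + v) * (k + 2 / (c * T)) =
            k * (c * c - v * v) + 2 * (c - v) / T * ((c + v) / c) by field; lra.
  apply: Rplus_le_compat_l.
  have h4 : 0 <= 2 * (c - v) / T by apply: Rdiv_le_0_compat; lra.
  have h5 : 1 <= (c + v) / c by apply/Rle_div_r => //; lra.
  nra.
have main : (c * c - u * u) * (Ju - Jv) >= (v * v - u * u) * (k - Jv) - 2 * (v - u) / T.
  have : (c * c - u * u) * Ju = (c * c - v * v) * Jv + 2 * (P v - P u) by lra.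
  move: low; rewrite /q; nra.
have D : 0 < (c - u) * (c + u) by nra.
suff : - (4 / (c * T)) * ((c - u) * (c + u)) <= (c * c - u * u) * (Ju - Jv) by nra.
apply: (Rle_trans _ ((v * v - u * u) * (k - Jv) - 2 * (v - u) / T)); last lra.
have h6 : (v * v - u * u) * (- (2 / (c * T))) <= (v * v - u * u) * (k - Jv).
  by apply: Rmult_le_compat_l; [nra|lra].
apply: (Rle_trans _ ((v * v - u * u) * (- (2 / (c * T))) - 2 * (v - u) / T)); last lra.
have -> : 2 * (v - u) / T = 2 / (c * T) * ((v - u) * c) by field; lra.
have -> : 4 / (c * T) = 2 * (2 / (c * T)) by field; lra.
have h7 : 0 < 2 / (c * T) by apply: Rdiv_lt_0_compat; nra.
suff : 2 * ((c - u) * (c + u)) >= (v * v - u * u) + (v - u) * c by nra.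
nra.
Qed.

(** * Products of several factors *)

Definition sprod (r : seq R) (t : R) : R := (\prod_(a <- r) sinc (a * t))%R.

Lemma sprod_nil t : sprod [::] t = 1.
Proof. by rewrite /sprod big_nil. Qed.

Lemma sprod_cons a r t : sprod (a :: r) t = sinc (a * t) * sprod r t.
Proof. by rewrite /sprod big_cons. Qed.

Lemma sprod_perm r s t : perm_eq r s -> sprod r t = sprod s t.
Proof. by move=> rs; apply: perm_big. Qed.

Lemma cts_sprod r : cts (sprod r).
Proof.
elim: r => [|a r IH].
  by apply: (cts_ext (fun _ => 1)); [move=> t; rewrite sprod_nil|exact: cts_const].
apply: (cts_ext (fun t => sinc (a * t) * sprod r t)) => [t|]; first by rewrite sprod_cons.
by apply: cts_mul => //; exact: cts_sinc.
Qed.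

Definition nonneg_seq (r : seq R) := forall a, a \in r -> 0 <= a.

Lemma nonneg_cons a r : nonneg_seq (a :: r) <-> 0 <= a /\ nonneg_seq r.
Proof.
split=> [h|[a0 h] b]; last by rewrite inE => /orP[/eqP->|/h].
by split=> [|b br]; apply: h; rewrite inE ?eqxx // br orbT.
Qed.

Lemma nonneg_perm r s : perm_eq r s -> nonneg_seq r -> nonneg_seq s.
Proof. by move=> rs h a as_; apply: h; rewrite (perm_mem rs). Qed.

(** [smoothing] once for each factor. *)
Lemma smoothing_sprod (G : R -> R) T e r : cts G -> 0 <= e -> nonneg_seq r ->
  (forall x, 0 <= x -> - e <= RInt (fun t => G t * phi x t) 0 T) ->
  forall x, 0 <= x -> - e <= RInt (fun t => G t * sprod r t * phi x t) 0 T.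
Proof.
move=> cG e0; elim: r => [_ He x x0|a r IH /nonneg_cons[a0 r0] He x x0].
  rewrite (RInt_eqf _ (fun t => G t * phi x t)); first exact: He.
  by move=> t; rewrite sprod_nil; ring.
rewrite (RInt_eqf _ (fun t => G t * sprod r t * sinc (a * t) * phi x t)).
  apply: smoothing => //; last by apply: IH.
  by apply: cts_mul => //; exact: cts_sprod.
by move=> t; rewrite sprod_cons; ring.
Qed.

(** * Transfers between two coordinates *)

(** A preorder on integrands that compares the improper integrals without
requiring that they exist. *)
Definition dominated (f g : R -> R) := forall e, 0 < e ->
  exists M, forall T, M < T -> RInt f 0 T <= RInt g 0 T + e.

Lemma dominated_eq f g : (forall t, f t = g t) -> dominated f g.
Proof. by move=> fg e e0; exists 0 => T _; rewrite (RInt_eqf _ _ _ _ fg); lra. Qed.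

Lemma dominated_trans f g h : dominated f g -> dominated g h -> dominated f h.
Proof.
move=> fg gh e e0; have e2 : 0 < e / 2 by lra.
have [M HM] := fg _ e2; have [N HN] := gh _ e2.
exists (Rmax M N) => T /Rmax_Rlt[/HM h1 /HN h2]; lra.
Qed.

Lemma sinc_mul_sinc a b t :
  sinc (a * t) * sinc (b * t) = trap (a + b) (Rabs (a - b)) t.
Proof.
rewrite /trap /Rabs; case: Rcase_abs => _.
- have -> : (a + b + - (a - b)) / 2 = b by lra.
  have -> : (a + b - - (a - b)) / 2 = a by lra.
  ring.
- have -> : (a + b + (a - b)) / 2 = a by lra.
  by have -> : (a + b - (a - b)) / 2 = b by lra.
Qed.

(** This is an integration by parts, (1 - cos t)/t being an antiderivative of
sin t / t - (1 - cos t) / t^2. It is obtained by differentiating in a the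
identity [RInt_psi], which avoids the boundary point t = 0. *)
Lemma RInt_phi a T : 0 < a -> RInt (phi a) 0 T = Psi (a * T) + a * T * psi 1 (a * T).
Proof.
move=> a0.
have d1 : is_derive (fun z => RInt (fun t => 1 * psi z t) 0 T) a
                    (RInt (fun t => 1 * phi a t) 0 T).
  by apply: is_derive_RInt_psi; exact: cts_const.
have d2 : is_derive (fun z => z * Psi (z * T)) a (Psi (a * T) + a * T * psi 1 (a * T)).
  have dc : is_derive (fun z => Psi (z * T)) a (T * psi 1 (a * T)).
    apply: (is_derive_comp Psi (fun z => z * T)); first exact: is_derive_Psi.
    by auto_derive => //; ring.
  have -> : Psi (a * T) + a * T * psi 1 (a * T) = 1 * Psi (a * T) + a * (T * psi 1 (a * T)) by ring.
  apply: (is_derive_mult (K := R_AbsRing) (fun z => z)) => //; first exact: is_derive_id.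
  by move=> n m; apply: Rmult_comm.
have -> : RInt (phi a) 0 T = RInt (fun t => 1 * phi a t) 0 T by apply: RInt_eqf => t; ring.
rewrite -(is_derive_unique _ _ _ d1) -(is_derive_unique _ _ _ d2).
apply: Derive_ext_loc; exists (mkposreal _ a0) => y.
move=> ya; have {ya} /Rabs_def2 ya : Rabs (y - a) < a := ya.
rewrite -RInt_psi; last lra.
by apply: RInt_eqf => t; ring.
Qed.

(** For b > 0 this is [RInt_phi_phi] divided by b; for b = 0, the Dirichlet
integral via [RInt_phi]. *)
Lemma pair_limit a b : 0 <= b -> b <= a -> 0 < a -> exists C, 0 <= C /\ forall T, 0 < T ->
  kappa - C / T <= a * RInt (fun t => sinc (a * t) * sinc (b * t)) 0 T <= kappa + C / T.
Proof.
move=> b0 ba a0.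
have cs : cts (fun t => sinc (a * t) * sinc (b * t)) by apply: cts_mul; exact: cts_sinc.
case: (Req_dec b 0) => [->|bn0].
  exists (2 / a); split => [|T T0]; first by apply: Rlt_le; apply: Rdiv_lt_0_compat; lra.
  rewrite -RInt_mull; last by apply: cts_mul; exact: cts_sinc.
  rewrite (RInt_eqf _ (phi a)); last by move=> t; rewrite Rmult_0_l sinc0 /phi; ring.
  rewrite RInt_phi // psiE; last by nra.
  have aT : 0 < a * T by nra.
  have [k1 k2] := kappa_bounds (a * T) aT.
  have -> : 2 / a / T = 2 / (a * T) by field; lra.
  have -> : a * T * ((1 - cos (1 * (a * T))) / (a * T * (a * T))) = (1 - cos (1 * (a * T))) * / (a * T).
    by field; lra.
  have [c1 c2] := COS_bound (1 * (a * T)).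
  have i0 : 0 < / (a * T) by exact: Rinv_0_lt_compat.
  rewrite /Rdiv in k1 k2 *; nra.
exists (/ b); split => [|T T0]; first by apply: Rlt_le; apply: Rinv_0_lt_compat; lra.
have [h1 h2] := RInt_phi_phi b a T b0 (Rlt_le _ _ a0) T0.
have E : b * (a * RInt (fun t => sinc (a * t) * sinc (b * t)) 0 T) =
         RInt (fun t => phi a t * phi b t) 0 T.
  by rewrite -Rmult_assoc -RInt_mull //; apply: RInt_eqf => t; rewrite /phi; ring.
rewrite -E Rmin_right // in h1 h2.
split; apply: (Rmult_le_reg_l b); try lra.
- have -> : b * (kappa - / b / T) = kappa * b - / T by field; lra.
  lra.
- have -> : b * (kappa + / b / T) = kappa * b + / T by field; lra.
  lra.
Qed.

Lemma div_le_eps C e T : 0 <= C -> 0 < e -> Rmax 0 (C / e) < T -> 0 < T /\ C / T <= e.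
Proof.
move=> C0 e0 /Rmax_Rlt[T0 CT]; split => //.
apply/Rle_div_l => //.
have : C / e * e < T * e by apply: Rmult_lt_compat_r.
have -> : C / e * e = C by field; lra.
lra.
Qed.

(** The limits are kappa / a and kappa / a', and a' <= a. *)
Lemma dominated_pair a b a' b' : 0 <= b -> b <= a -> 0 < b' -> b' <= a' -> a' <= a ->
  dominated (fun t => sinc (a * t) * sinc (b * t)) (fun t => sinc (a' * t) * sinc (b' * t)).
Proof.
move=> b0 ba b0' ba' aa e e0.
have a0' : 0 < a' by lra.
have a0 : 0 < a by lra.
have [C [C0 HC]] := pair_limit a b b0 ba a0.
have [C' [C0' HC']] := pair_limit a' b' (Rlt_le _ _ b0') ba' a0'.
have e1 : 0 < e / 2 * a' by apply: Rmult_lt_0_compat; lra.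
exists (Rmax (Rmax 0 (C / (e / 2 * a'))) (Rmax 0 (C' / (e / 2 * a')))) => T /Rmax_Rlt[].
move=> /(div_le_eps _ _ _ C0 e1)[T0 CT] /(div_le_eps _ _ _ C0' e1)[_ CT'].
have [_ h] := HC T T0; have [h' _] := HC' T T0.
move: h h'; set I := RInt _ _ _; set J := RInt _ _ _ => h h'.
have k0 := kappa_ge0.
have h1 : a' * J >= kappa - e / 2 * a' by lra.
have h2 : a * I <= kappa + e / 2 * a' by lra.
have h3 : J >= kappa / a' - e / 2.
  apply: Rle_ge; apply: (Rmult_le_reg_l a') => //.
  have -> : a' * (kappa / a' - e / 2) = kappa - e / 2 * a' by field; lra.
  lra.
have h4 : I <= kappa / a' + e / 2.
  apply: (Rmult_le_reg_l a) => //.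
  have -> : a * (kappa / a' + e / 2) = kappa * (a / a') + e / 2 * a by field; lra.
  have h5 : 1 <= a / a' by apply/Rle_div_r => //; lra.
  nra.
lra.
Qed.

Lemma sprod_zeros r t : (forall a, a \in r -> a = 0) -> sprod r t = 1.
Proof.
elim: r => [|a r IH] h; first exact: sprod_nil.
rewrite sprod_cons IH; last by move=> b br; apply: h; rewrite inE br orbT.
by rewrite (h a) ?inE ?eqxx // Rmult_0_l sinc0; ring.
Qed.

Lemma positive_or_zeros r : nonneg_seq r ->
  (exists2 x, x \in r & 0 < x) \/ (forall a, a \in r -> a = 0).
Proof.
elim: r => [_|a r IH /nonneg_cons[a0 /IH[[x xr x0]|z]]]; first by right.
  by left; exists x => //; rewrite inE xr orbT.
case: (Req_dec a 0) => [->|an0]; first by right => b; rewrite inE => /orP[/eqP|/z].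
by left; exists a; [rewrite inE eqxx|lra].
Qed.

(** If some coordinate x of r is positive, its factor x * sinc (x .) = phi x is
used as the test kernel for the difference of the two trapezoids, smoothed by
the remaining coordinates; otherwise only the two moved coordinates matter. *)
Lemma dominated_transfer a b a' b' r : 0 <= b -> b <= a -> 0 < b' -> b' <= a' ->
  a' <= a -> a + b = a' + b' -> nonneg_seq r ->
  dominated (sprod (a :: b :: r)) (sprod (a' :: b' :: r)).
Proof.
move=> b0 ba b0' ba' aa E r0.
have [[x xr x0]|z] := positive_or_zeros r r0; last first.
  have one u v : forall t, sprod (u :: v :: r) t = sinc (u * t) * sinc (v * t).
    by move=> t; rewrite !sprod_cons sprod_zeros //; ring.
  apply: dominated_trans (dominated_eq _ _ (one a b)) _.
  apply: dominated_trans (dominated_pair a b a' b' b0 ba b0' ba' aa) _.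
  by apply: dominated_eq => t; rewrite one.
set p := rem x r; have rp : perm_eq r (x :: p) by exact: perm_to_rem.
have p0 : nonneg_seq p by case/nonneg_cons: (nonneg_perm _ _ rp r0).
set c := a + b; have c0 : 0 < c by rewrite /c; lra.
have tr u v t : u + v = c -> v <= u -> sprod (u :: v :: r) t = trap c (u - v) t * sinc (x * t) * sprod p t.
  move=> uv vu; rewrite !sprod_cons -Rmult_assoc sinc_mul_sinc uv Rabs_pos_eq; last lra.
  by rewrite (sprod_perm _ _ _ rp) sprod_cons; ring.
move=> e e0; exists (Rmax 0 (4 / (c * x) / e)) => T.
have cx : 0 <= 4 / (c * x) by apply: Rlt_le; apply: Rdiv_lt_0_compat; nra.
move=> /(div_le_eps _ _ _ cx e0)[T0 Te].
have := smoothing_sprod (fun t => trap c (a' - b') t - trap c (a - b) t) T (4 / (c * T)) p.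
move=> /(_ (cts_sub _ _ (cts_trap _ _) (cts_trap _ _))).
have cT : 0 <= 4 / (c * T) by apply: Rlt_le; apply: Rdiv_lt_0_compat; nra.
move=> /(_ cT p0) H.
have /H /(_ x (Rlt_le _ _ x0)) : forall x, 0 <= x ->
    - (4 / (c * T)) <= RInt (fun t => (trap c (a' - b') t - trap c (a - b) t) * phi x t) 0 T.
  by move=> y y0; apply: trap_antitone; rewrite /c; lra.
have -> : RInt (fun t => (trap c (a' - b') t - trap c (a - b) t) * sprod p t * phi x t) 0 T =
    x * (RInt (sprod (a' :: b' :: r)) 0 T - RInt (sprod (a :: b :: r)) 0 T).
  rewrite -RInt_subf; [|exact: cts_sprod|exact: cts_sprod].
  rewrite -RInt_mull; last by apply: cts_sub; exact: cts_sprod.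
  by apply: RInt_eqf => t; rewrite !tr // /phi; ring.
move=> h.
suff : x * (RInt (sprod (a :: b :: r)) 0 T - RInt (sprod (a' :: b' :: r)) 0 T) <= x * e.
  by move=> /(Rmult_le_reg_l _ _ _ x0); lra.
have -> : x * (RInt (sprod (a :: b :: r)) 0 T - RInt (sprod (a' :: b' :: r)) 0 T) =
  - (x * (RInt (sprod (a' :: b' :: r)) 0 T - RInt (sprod (a :: b :: r)) 0 T)) by ring.
have : 4 / (c * T) <= x * e.
  have -> : 4 / (c * T) = x * (4 / (c * x) / T) by field; lra.
  by apply: Rmult_le_compat_l; lra.
lra.
Qed.

Lemma dominated_perm r s : perm_eq r s -> dominated (sprod r) (sprod s).
Proof. by move=> rs; apply: dominated_eq => t; apply: sprod_perm. Qed.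

(** The new pair has the same sum and lies between a and b; which of its two
members is larger is immaterial. *)
Lemma dominated_to_mean a b mu r : 0 <= a -> a <= mu -> mu <= b -> 0 < mu -> nonneg_seq r ->
  dominated (sprod (a :: b :: r)) (sprod (mu :: a + b - mu :: r)).
Proof.
move=> a0 am mb m0 r0.
case: (Req_dec b mu) => [->|bm].
  have -> : a + mu - mu = a by ring.
  by apply: dominated_perm; rewrite (perm_catCA [:: a] [:: mu] r).
have sw u v : perm_eq (u :: v :: r) (v :: u :: r) by rewrite (perm_catCA [:: u] [:: v] r).
apply: dominated_trans (dominated_perm _ _ (sw a b)) _.
case: (Rle_dec mu (a + b - mu)) => h.
  apply: dominated_trans _ (dominated_perm _ _ (sw (a + b - mu) mu)).
  by apply: dominated_transfer => //; lra.
by apply: dominated_transfer => //; lra.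
Qed.

(** * Levelling all coordinates *)

Definition lsum (r : seq R) : R := (\sum_(a <- r) a)%R.

Lemma lsum_cons a r : lsum (a :: r) = a + lsum r.
Proof. by rewrite /lsum big_cons. Qed.

Lemma lsum_perm r s : perm_eq r s -> lsum r = lsum s.
Proof. by move=> rs; apply: perm_big. Qed.

Lemma exists_le_mean (mu : R) (r : seq R) : r != [::] -> lsum r <= INR (size r) * mu ->
  exists2 a, a \in r & a <= mu.
Proof.
elim: r => // a r IH _; rewrite lsum_cons [size _]/= S_INR => h.
case: (Rle_dec a mu) => am; first by exists a => //; rewrite inE eqxx.
case: (eqVneq r [::]) => [r0|rn0].
  by move: h; rewrite r0 /lsum big_nil /= => h; exfalso; change (GRing.zero) with 0 in h; lra.
have [|b br bm] := IH rn0; first lra.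
by exists b => //; rewrite inE br orbT.
Qed.

Lemma exists_ge_mean (mu : R) (r : seq R) : r != [::] -> INR (size r) * mu <= lsum r ->
  exists2 a, a \in r & mu <= a.
Proof.
elim: r => // a r IH _; rewrite lsum_cons [size _]/= S_INR => h.
case: (Rle_dec mu a) => am; first by exists a => //; rewrite inE eqxx.
case: (eqVneq r [::]) => [r0|rn0].
  by move: h; rewrite r0 /lsum big_nil /= => h; exfalso; change (GRing.zero) with 0 in h; lra.
have [|b br bm] := IH rn0; first lra.
by exists b => //; rewrite inE br orbT.
Qed.

(** A list whose mean is mu has an entry a <= mu and, among the others, an entry
b >= mu. Replacing them by mu and a + b - mu keeps the mean, and leaves one
entry fewer to treat; m counts the entries already equal to mu. *)
Lemma dominated_mean mu r m : 0 < mu -> nonneg_seq r -> lsum r = INR (size r) * mu ->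
  dominated (sprod (r ++ nseq m mu)) (sprod (nseq (size r + m) mu)).
Proof.
move=> m0; move En : (size r) => n; elim: n r m En => [|n IH] r m En r0 S.
  by rewrite (size0nil En); apply: dominated_eq.
have rn : r != [::] by rewrite -size_eq0 En.
have [|a ar am] := exists_le_mean mu r rn; first by rewrite En; lra.
have rp := perm_to_rem ar; set p := rem a r in rp.
have sp : size p = n by have := perm_size rp; rewrite En /= => -[].
have /nonneg_cons[a0 p0] := nonneg_perm _ _ rp r0.
have Sp : a + lsum p = (INR n + 1) * mu by rewrite -lsum_cons -(lsum_perm _ _ rp) S S_INR.
case: (eqVneq p [::]) => [pn|pn].
  have n0 : n = 0%N by rewrite -sp pn.
  have amu : a = mu by move: Sp; rewrite pn /lsum big_nil n0 /=; change (GRing.zero) with 0; lra.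
  apply: dominated_perm; rewrite n0; apply: (perm_trans (y := (a :: p) ++ nseq m mu)).
    by rewrite perm_cat2r.
  by rewrite pn amu.
have [|b bp bm] := exists_ge_mean mu p pn; first by rewrite sp; lra.
have pq := perm_to_rem bp; set q := rem b p in pq.
have /nonneg_cons[b0 q0] := nonneg_perm _ _ pq p0.
have sq : size p = (size q).+1 by have := perm_size pq.
have q0' : nonneg_seq (q ++ nseq m mu).
  by move=> x; rewrite mem_cat => /orP[/q0//|/nseqP[-> _]]; lra.
have st1 : perm_eq (r ++ nseq m mu) (a :: b :: q ++ nseq m mu).
  apply: (perm_trans (y := (a :: p) ++ nseq m mu)); first by rewrite perm_cat2r.
  by rewrite /= perm_cons -cat_cons perm_cat2r.
apply: dominated_trans (dominated_perm _ _ st1) _.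
apply: dominated_trans (dominated_to_mean a b mu _ a0 am bm m0 q0') _.
have := IH (a + b - mu :: q) m.+1.
rewrite addSnnS => H.
apply: dominated_trans _ (H _ _ _).
- apply: dominated_perm.
  by rewrite (perm_catCA [:: mu] (a + b - mu :: q) (nseq m mu)).
- by rewrite /= -sq.
- by apply/nonneg_cons; split => //; lra.
by move: Sp; rewrite (lsum_perm _ _ pq) !lsum_cons; lra.
Qed.

(** * Improper integrals *)

Definition tends (f : R -> R) (l : R) := forall e, 0 < e ->
  exists M, forall T, M < T -> Rabs (RInt f 0 T - l) < e.

Lemma tends_improper f l : cts f -> tends f l ->
  is_RInt_gen f (at_point 0) (Rbar_locally p_infty) l.
Proof.
move=> cf fl P [e He]; have [M HM] := fl e (cond_pos e).
apply: (Filter_prod _ _ _ (fun x => x = 0) (fun T => M < T)) => //; first by exists M.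
move=> x T -> MT; exists (RInt f 0 T); split.
  by apply: RInt_correct; apply: ex_RInt_cts.
exact: (He _ (HM T MT)).
Qed.

Lemma tends_ext f g l : (forall t, f t = g t) -> tends f l -> tends g l.
Proof. by move=> fg fl e /fl[M HM]; exists M => T /HM; rewrite (RInt_eqf _ _ _ _ fg). Qed.

Lemma tends_le f g k l : dominated f g -> tends f k -> tends g l -> k <= l.
Proof.
move=> fg fk gl; apply: le_epsilon => e e0.
have e3 : 0 < e / 3 by lra.
have [M HM] := fg _ e3; have [N HN] := fk _ e3; have [O HO] := gl _ e3.
pose T := Rmax M (Rmax N O) + 1.
have [] : [/\ M < T, N < T & O < T].
  by rewrite /T; have := Rmax_l M (Rmax N O); have := Rmax_r M (Rmax N O);
     have := Rmax_l N O; have := Rmax_r N O; split; lra.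
move=> /HM h1 /HN /Rabs_def2 h2 /HO /Rabs_def2 h3; lra.
Qed.

Lemma tends_scale f l c : 0 < c -> cts f -> tends f l -> tends (fun t => f (c * t)) (l / c).
Proof.
move=> c0 cf fl e e0; have ce : 0 < c * e by nra.
have [M HM] := fl _ ce; exists (M / c) => T /Rlt_div_l MT.
have {}MT : M < c * T by have := MT c0; lra.
have E : c * RInt (fun t => f (c * t)) 0 T = RInt f 0 (c * T).
  have := RInt_comp_lin f c 0 0 T; rewrite !Rplus_0_r Rmult_0_r => <-; last exact: ex_RInt_cts.
  rewrite -RInt_mull.
    by apply: RInt_eqf => t; rewrite Rplus_0_r.
  move=> t; apply: (continuous_comp (fun t => c * t) f); last exact: cf.
  by apply: (@ex_derive_continuous R_AbsRing R_NormedModule); auto_derive.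
apply: (Rmult_lt_reg_l c) => //.
rewrite -{1}(Rabs_pos_eq c) -?Rabs_mult; last lra.
have -> : c * (RInt (fun t => f (c * t)) 0 T - l / c) =
  c * RInt (fun t => f (c * t)) 0 T - l by field; lra.
by rewrite E; apply: HM.
Qed.

(** The integrals over [V, W] are at most C / V in absolute value, so the
Cauchy criterion applies. *)
Lemma tends_of_bound f C : cts f -> 0 <= C ->
  (forall t, 0 < t -> Rabs (f t) <= C / (t * t)) -> exists l, tends f l.
Proof.
move=> cf C0 fC.
have dI u : is_derive (RInt f 0) u (f u).
  apply: (is_derive_RInt f _ 0); last exact: cf.
  by apply: filter_forall => b; apply: RInt_correct; apply: ex_RInt_cts.
have dq k u : 0 < u -> is_derive (fun z => k / z) u (- k / (u * u)).
  by move=> u0; auto_derive; [lra|field; lra].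
have tail V W : 0 < V -> V <= W -> Rabs (RInt f 0 W - RInt f 0 V) <= C / V.
  move=> V0 VW; have W0 : 0 <= C / W by apply: Rdiv_le_0_compat; lra.
  apply: Rabs_le; split.
    have : C / W - C / V <= RInt f 0 W - RInt f 0 V; last lra.
    apply: (increment_le (RInt f 0) (fun z => C / z) f (fun z => - C / (z * z))) => // u uVW.
      by apply: dq; lra.
    have := fC u ltac:(lra); move/Rabs_le_between; rewrite /Rdiv; lra.
  have : RInt f 0 W - RInt f 0 V <= - C / W - (- C / V); last by rewrite /Rdiv; lra.
  apply: (increment_le (fun z => - C / z) (RInt f 0) (fun z => - - C / (z * z)) f) => // u uVW.
    by apply: dq; lra.
  have := fC u ltac:(lra); move/Rabs_le_between; rewrite /Rdiv; lra.
have cau : forall e : posreal, exists P, Rbar_locally p_infty P /\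
    forall V W, P V -> P W -> ball (RInt f 0 V) e (RInt f 0 W).
  move=> e; exists (fun T => Rmax 0 (C / (e / 2)) < T); split; first by exists (Rmax 0 (C / (e / 2))).
  have e2 : 0 < e / 2 by have := cond_pos e; lra.
  have key V W : Rmax 0 (C / (e / 2)) < V -> V <= W -> Rabs (RInt f 0 W - RInt f 0 V) < e.
    move=> /(div_le_eps _ _ _ C0 e2)[V0 Ve] VW; have := tail V W V0 VW; lra.
  move=> V W HV HW; change (Rabs (RInt f 0 W - RInt f 0 V) < e).
  case: (Rle_dec V W) => VW; first by apply: key.
  by rewrite Rabs_minus_sym; apply: key => //; lra.
have [l Hl] := proj1 (filterlim_locally_cauchy (F := Rbar_locally p_infty) (RInt f 0)) cau.
exists l => e e0; have := Hl _ (locally_ball l (mkposreal e e0)).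
by case=> M HM; exists M => T /HM.
Qed.

Lemma Rabs_sprod_le1 r t : Rabs (sprod r t) <= 1.
Proof.
elim: r => [|a r IH]; first by rewrite sprod_nil Rabs_R1; lra.
rewrite sprod_cons Rabs_mult; have := Rabs_sinc_le1 (a * t); have := Rabs_pos (sinc (a * t)).
have := Rabs_pos (sprod r t); nra.
Qed.

Lemma Rabs_sinc_le_inv a t : 0 < a -> 0 < t -> Rabs (sinc (a * t)) <= / (a * t).
Proof.
move=> a0 t0; have at0 : 0 < a * t by nra.
rewrite sincE; last lra.
rewrite /Rdiv Rabs_mult (Rabs_pos_eq (/ _)); last by apply: Rlt_le; apply: Rinv_0_lt_compat.
have h : Rabs (sin (a * t)) <= 1 by apply: Rabs_le; have := SIN_bound (a * t); lra.
have : 0 < / (a * t) by apply: Rinv_0_lt_compat.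
nra.
Qed.

(** Two positive coordinates give a bound by a multiple of 1/t^2. A single one
gives a Dirichlet integral, which converges only conditionally. *)
Lemma sprod_tends r : nonneg_seq r -> 0 < lsum r -> exists l, tends (sprod r) l.
Proof.
move=> r0 S.
have [[a ar a0]|z] := positive_or_zeros r r0; last first.
  exfalso; suff : lsum r = 0 by lra.
  by rewrite /lsum big_seq big1 // => a /z.
have rp := perm_to_rem ar; set p := rem a r in rp.
have /nonneg_cons[_ p0] := nonneg_perm _ _ rp r0.
have [[b bp b0]|z] := positive_or_zeros p p0; last first.
  exists (kappa / a); apply: (tends_ext (fun t => sinc (a * t) * sinc (0 * t))) => [t|].
    by rewrite (sprod_perm _ _ _ rp) sprod_cons sprod_zeros // Rmult_0_l sinc0.
  have [C [C0 HC]] := pair_limit a 0 (Rle_refl 0) (Rlt_le _ _ a0) a0.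
  move=> e e0; have ae : 0 < a * e / 2 by nra.
  exists (Rmax 0 (C / (a * e / 2))) => T /(div_le_eps _ _ _ C0 ae)[T0 CT].
  have := HC T T0; set I := RInt _ _ _ => h.
  apply: (Rmult_lt_reg_l a) => //.
  rewrite -{1}(Rabs_pos_eq a) -?Rabs_mult; last lra.
  have -> : a * (I - kappa / a) = a * I - kappa by field; lra.
  by apply: Rabs_def1; lra.
have pq := perm_to_rem bp; set q := rem b p in pq.
apply: (tends_of_bound _ (/ (a * b))); first exact: cts_sprod.
  by apply: Rlt_le; apply: Rinv_0_lt_compat; nra.
move=> t t0.
rewrite (sprod_perm _ _ _ rp) sprod_cons (sprod_perm _ _ _ pq) sprod_cons !Rabs_mult.
have -> : / (a * b) / (t * t) = / (a * t) * (/ (b * t) * 1) by field; lra.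
apply: Rmult_le_compat; [exact: Rabs_pos| |exact: Rabs_sinc_le_inv|].
  by apply: Rmult_le_pos; exact: Rabs_pos.
apply: Rmult_le_compat; [exact: Rabs_pos|exact: Rabs_pos|exact: Rabs_sinc_le_inv|].
exact: Rabs_sprod_le1.
Qed.

(** * The sharp bound *)

Lemma sprod_nseq d mu t : sprod (nseq d mu) t = sinc_pow d (mu * t).
Proof.
rewrite /sinc_pow; elim: d => [|d IH]; first by rewrite sprod_nil.
by rewrite /= sprod_cons IH exprS.
Qed.

Lemma lsum_nseq d mu : lsum (nseq d mu) = INR d * mu.
Proof.
elim: d => [|d IH]; first by rewrite /lsum big_nil Rmult_0_l.
by rewrite [nseq _ _]/= lsum_cons IH S_INR; ring.
Qed.

(** The integral of sinc^d (mu .) is that of sinc^d divided by mu. *)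
Lemma sprod_tends_le d mu r k l : 0 < mu -> nonneg_seq r -> size r = d -> lsum r = INR d * mu ->
  tends (sprod r) k -> tends (sinc_pow d) l -> k <= l / mu.
Proof.
move=> mu0 r0 sr S tk tl.
have c1 : cts (sinc_pow d).
  by apply: (cts_ext (sprod (nseq d 1))) => [t|]; [rewrite sprod_nseq Rmult_1_l|exact: cts_sprod].
apply: (tends_le (sprod r) (sprod (nseq d mu))) => //.
  have := dominated_mean mu r 0 mu0 r0; rewrite cats0 addn0 sr; exact.
apply: (tends_ext (fun t => sinc_pow d (mu * t))) => [t|]; first by rewrite sprod_nseq.
exact: tends_scale.
Qed.

Lemma tends_improper_eq f l : cts f -> tends f l -> ex_improper f /\ improper f = l.
Proof.
move=> cf fl; have h := tends_improper f l cf fl; split; first by exists l.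
exact: (@is_RInt_gen_unique R_CompleteNormedModule (at_point 0) (Rbar_locally p_infty) _ _ f l h).
Qed.

Definition abs_coords d (s : 'rV[R]_d) : seq R := [seq Rabs (s ord0 i) | i <- enum 'I_d].

Lemma sprod_abs_coords d (s : 'rV[R]_d) t : sprod (abs_coords d s) t = sinc_prod s t.
Proof.
rewrite /sprod /sinc_prod /abs_coords big_map big_enum /=; apply: eq_bigr => i _.
rewrite /Rabs; case: Rcase_abs => // _.
by rewrite -[in RHS]sincN; congr sinc; change (- s ord0 i * t = - (s ord0 i * t)); ring.
Qed.

Lemma lsum_abs_coords d (s : 'rV[R]_d) : lsum (abs_coords d s) = l1norm s.
Proof. by rewrite /lsum /l1norm big_map big_enum; apply: eq_bigr => i _; rewrite RabsE. Qed.

Lemma l1norm_gt0 d (s : 'rV[R]_d) : l2norm s = 1 -> 0 < l1norm s.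
Proof.
move=> su; apply/RltP; rewrite lt_neqAle sumr_ge0 ?andbT //.
apply/negP; rewrite eq_sym psumr_eq0 // => /allP s0.
move: su; rewrite /l2norm big1 ?sqrtr0 => [/eqP|i _]; first by rewrite eq_sym oner_eq0.
have := s0 i (mem_index_enum _); rewrite normr_eq0 => /eqP ->; by rewrite expr0n.
Qed.

Local Open Scope ring_scope.

Theorem corollary2 (d : nat) (d_ge2 : (2 <= d)%N) (s : 'rV[R]_d)
    (s_unit : l2norm s = 1) :
  [/\ ex_improper (sinc_pow d),
      ex_improper (sinc_prod s)
    & 2 * l1norm s / (PI * d%:R) * improper (sinc_prod s) <= sigma_d d].
Proof.
have S0 := l1norm_gt0 d s s_unit.
have d0 : Rlt 0 (INR d) by apply: lt_0_INR; apply/ssrnat.ltP; apply: ltn_trans d_ge2.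
have r0 : nonneg_seq (abs_coords d s) by move=> a /mapP[i _ ->]; exact: Rabs_pos.
have sr : size (abs_coords d s) = d by rewrite size_map size_enum_ord.
have [k tk] : exists k, tends (sprod (abs_coords d s)) k.
  by apply: sprod_tends => //; rewrite lsum_abs_coords.
have [l tl] : exists l, tends (sprod (nseq d 1)) l.
  apply: sprod_tends; first by move=> a /nseqP[-> _]; exact: Rle_0_1.
  by rewrite lsum_nseq Rmult_1_r.
have Ek t := sprod_abs_coords d s t.
have El t : sprod (nseq d 1) t = sinc_pow d t by rewrite sprod_nseq Rmult_1_l.
have {}tl := tends_ext _ _ _ El tl.
have [exk imk] := tends_improper_eq _ _ (cts_ext _ _ Ek (cts_sprod _)) (tends_ext _ _ _ Ek tk).
have [exl iml] := tends_improper_eq _ _ (cts_ext _ _ El (cts_sprod _)) tl.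
split => //; rewrite /sigma_d imk iml -(INRE d); apply/RleP.
pose mu := Rdiv (l1norm s) (INR d).
have mu0 : Rlt 0 mu by exact: Rdiv_lt_0_compat.
have kl : Rle k (Rdiv l mu).
  apply: (sprod_tends_le d mu _ k l mu0 r0 sr _ tk tl).
  by rewrite lsum_abs_coords /mu; field; lra.
have P0 := PI_RGT_0.
have -> : 2 = IZR 2 by rewrite -(INRE 2).
change (Rle (Rmult (Rdiv (Rmult (IZR 2) (l1norm s)) (Rmult PI (INR d))) k)
            (Rmult (Rdiv (IZR 2) PI) l)).
have -> : Rmult (Rdiv (Rmult (IZR 2) (l1norm s)) (Rmult PI (INR d))) k =
          Rmult (Rdiv (IZR 2) PI) (Rmult mu k).
  by rewrite /mu; field; lra.
apply: Rmult_le_compat_l; first by apply: Rlt_le; apply: Rdiv_lt_0_compat; lra.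
apply: (Rle_trans _ (Rmult mu (Rdiv l mu))); first by apply: Rmult_le_compat_l => //; lra.
by right; field; lra.
Qed.
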